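(* Let $(X,d)$ be a metric space, let $r\ge 1$ be an integer, and let $T_1,\ldots,T_r:X\to X$ be mappings each satisfying property $(P_1)$. Suppose $\bigcap_{i=1}^r \mathrm{Fix}(T_i)\neq\emptyset$. Let $(\varepsilon_n)_{n\in\mathbb{N}}$ be nonnegative reals with $\sum_{n=0}^\infty\varepsilon_n<\infty$, let $x_0\in X$ be any starting point, and let $(x_n)$ be any sequence in $X$ starting at $x_0$ with $$d(x_{n+1},T_{\overline{n}}x_n)\le\varepsilon_n\quad\text{for each } n\in\mathbb{N},$$ where $\overline{n}=(n \bmod r)+1$. Then $(x_n)$ is asymptotically regular, i.e. $\lim_{n\to\infty}d(x_n,x_{n+1})=0$.
   Context: $\mathbb{N}=\{0,1,2,\ldots\}$. $\mathrm{Fix}(T)$ denotes the set of fixed points of $T$. A mapping $T:C\to X$, with $C$ a nonempty subset of a metric space $(X,d)$, satisfies property $(P_1)$ iff $\mathrm{Fix}(T)\neq\emptyset$ and there exist $l>0$ and $\beta>0$ such that $d(Tx,u)^l\le d(x,u)^l-\beta\, d(Tx,x)^l$ for all $x\in C$ and $u\in\mathrm{Fix}(T)$. *)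

(* Defs.v *)
From HB Require Import structures.
From mathcomp Require Export all_boot all_order all_algebra.
From mathcomp Require Export all_classical all_reals all_analysis.
Export numFieldNormedType.Exports.

Set Implicit Arguments.
Unset Strict Implicit.
Unset Printing Implicit Defensive.

Import Order.TTheory GRing.Theory Num.Theory.

Local Open Scope classical_set_scope.
Local Open Scope ring_scope.

(* A mapping C -> X is encoded as a total function on X of which only the
   restriction to C matters; a self-mapping of X is the case C = [set: X]. *)
Definition Fix (X : Type) (C : set X) (T : X -> X) : set X :=
  [set x | C x /\ T x = x].

(* C is automatically nonempty, since Fix C T is. *)
Definition propertyP1 (R : realType) (X : metricType R) (C : set X)
    (T : X -> X) : Prop :=
  Fix C T !=set0 /\
  exists l beta : R, [/\ 0 < l, 0 < beta &
    forall x u : X, C x -> Fix C T u ->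
      mdist (T x) u `^ l <= mdist x u `^ l - beta * mdist (T x) x `^ l].

Definition asymptotically_regular (R : realType) (X : metricType R)
    (x : nat -> X) : Prop :=
  mdist (x n) (x n.+1) @[n --> \oo] --> (0 : R).

(* Main.v *)
Require Import Defs.
From mathcomp Require Import lra.
Import Order.TTheory GRing.Theory Num.Theory.
Local Open Scope classical_set_scope.
Local Open Scope ring_scope.

(** Let [p] be a common fixed point. Up to summable errors the distances
    [d(x_n, p)] are nonincreasing, hence they converge, and
    [d(T_n x_n, p)], squeezed between [d(x_{n+1}, p) - eps_n] and [d(x_n, p)],
    has the same limit. Property (P_1) bounds [beta * d(T_n x_n, x_n)^l] by the
    difference of the [l]-th powers of these two distances, which tends to [0]
    for each of the finitely many exponents [l]. *)

(** For [a > 0] this is continuity of [expR (l * ln t)] at [a]. At [a = 0], where [ln] is of no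
    help, monotonicity of the power does the work: [f t < e]^ l^-1[gives]f t [^ l < e]. *)
Lemma cvg_powR_ge0 {R : realType} {T : Type} {F : set_system T}
    {FF : Filter F} {f : T -> R} {a l : R} :
  0 < l -> (forall t, 0 <= f t) -> 0 <= a ->
  f t @[t --> F] --> a -> f t `^ l @[t --> F] --> a `^ l.
Proof.
move=> l0 f0; rewrite le_eqVlt => /predU1P[<-|a0] fa.
  rewrite powR0 ?gt_eqF//; apply/cvgr0Pnorm_lt => e e0.
  have e'0 : 0 < e `^ l^-1 by exact: powR_gt0.
  have /cvgr0Pnorm_lt/(_ _ e'0) := fa.
  apply: filterS => t; rewrite ger0_norm// ger0_norm ?powR_ge0// => fte.
  rewrite -[ltRHS]powRr1 ?ltW// -(mulVf (lt0r_neq0 l0)) powRrM.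
  by apply: gt0_ltr_powR; rewrite ?nnegrE// ltW.
rewrite {2}/powR gt_eqF//.
(* Since [a > 0], [f t] is eventually nonzero, so its power is eventually given by the exponential
   formula. *)
apply: (@cvg_trans _ (expR (l * ln (f t)) @[t --> F])).
  apply: near_eq_cvg; have /(cvgr_gt a)/(_ _ a0) := fa.
  by apply: filterS => t ft; rewrite /powR gt_eqF.
apply: (cvg_comp _ expR); last exact: continuous_expR.
apply: cvgM; first exact: cvg_cst.
by apply: (cvg_comp _ (@ln R) fa); exact: continuous_ln.
Qed.

(** Subtracting from [a] the partial sums of [eps] leaves a nonincreasing sequence, bounded below by
    minus the total error. *)
Lemma cvgn_quasi_nonincreasing {R : realType} {a : R^nat} (eps : R^nat) :
  (forall n, 0 <= a n) -> (forall n, 0 <= eps n) -> cvgn (series eps) ->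
  (forall n, a n.+1 <= a n + eps n) -> cvgn a.
Proof.
move=> a0 e0 ce ha.
have -> : a = (a - series eps) + series eps by rewrite subrK.
apply: is_cvgD => //; apply: nonincreasing_is_cvgn.
  apply/nonincreasing_seqP => n; rewrite !fctE /series/= big_nat_recr//=.
  by have := ha n; lra.
exists (- limn (series eps)) => _ [n _ <-]; rewrite !fctE.
suff : series eps n <= limn (series eps) by have := a0 n; lra.
apply: nondecreasing_cvgn_le => //.
by apply/nondecreasing_seqP => m; rewrite /series/= big_nat_recr//= lerDl.
Qed.

(** Dropping the nonnegative displacement term compares the [l]-th powers, and the power is strictly
    increasing on nonnegative reals. *)
Lemma propertyP1_quasi_nonexpansive {R : realType} {X : metricType R}
    {C : set X} {T : X -> X} {x u : X} :
  propertyP1 C T -> C x -> Fix C T u -> mdist (T x) u <= mdist x u.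
Proof.
move=> [_ [l [b [l0 b0 H]]]] Cx Fu.
rewrite leNgt; apply/negP => /(gt0_ltr_powR l0).
rewrite !nnegrE !mdist_ge0 => /(_ isT isT); apply/negP; rewrite -leNgt.
by rewrite (le_trans (H _ _ Cx Fu))// gerBl mulr_ge0 ?powR_ge0 ?ltW.
Qed.

(** [D] stands for the times at which [T] is the applied map. *)
Lemma propertyP1_displacement_cvg0 {R : realType} {X : metricType R}
    {C : set X} {T : X -> X} {x : nat -> X} (b : R^nat) (D : set nat)
    {u : X} {a : R} :
  propertyP1 C T -> Fix C T u -> (forall n, C (x n)) ->
  (forall n, 0 <= b n) -> (forall n, D n -> b n = mdist (T (x n)) u) ->
  mdist (x n) u @[n --> \oo] --> a -> b @ \oo --> a ->
  forall e, 0 < e -> \forall n \near \oo, D n -> mdist (T (x n)) (x n) < e.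
Proof.
move=> [_ [l [c [l0 c0 H]]]] Fu Cx b0 bE xa ba e e0.
have a0 : 0 <= a.
  by rewrite -(cvg_lim _ ba)//; apply: limr_ge; [exact: cvgP ba|exact: nearW].
have ce0 : 0 < c * e `^ l by rewrite mulr_gt0 ?powR_gt0.
have : mdist (x n) u `^ l - b n `^ l @[n --> \oo] --> (0 : R).
  rewrite -(subrr (a `^ l)).
  by apply: cvgB; apply: cvg_powR_ge0 => // n; exact: mdist_ge0.
move=> /cvgr0Pnorm_lt/(_ _ ce0); apply: filterS => n.
move=> /ltr_normlW + Dn; rewrite bE// => lt_ce.
rewrite ltNge; apply/negP => /(ge0_ler_powR (ltW l0)).
rewrite !nnegrE (ltW e0) mdist_ge0 => /(_ isT isT).
apply/negP; rewrite -ltNge -(ltr_pM2l c0) (le_lt_trans _ lt_ce)//.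
by have := H _ _ (Cx n) Fu; lra.
Qed.

Theorem theorem3p1 (R : realType) (X : metricType R) (r : nat)
    (r_ge1 : (1 <= r)%N) (T : 'I_r -> X -> X)
    (T_P1 : forall i : 'I_r, propertyP1 [set: X] (T i))
    (common_fix : \bigcap_i Fix [set: X] (T i) !=set0)
    (eps : nat -> R) (eps_ge0 : forall n, 0 <= eps n)
    (eps_summable : cvgn (series eps))
    (x0 : X) (x : nat -> X) (x_start : x 0%N = x0)
    (x_step : forall n : nat,
      mdist (x n.+1) (T (Ordinal (ltn_pmod n r_ge1)) (x n)) <= eps n) :
  asymptotically_regular x.
Proof.
case: common_fix => p pfix.
pose s n := Ordinal (ltn_pmod n r_ge1).
pose a n := mdist (x n) p; pose b n := mdist (T (s n) (x n)) p.
have ba n : b n <= a n.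
  by apply: (propertyP1_quasi_nonexpansive (T_P1 _)) => //; exact: pfix.
have ab n : a n.+1 <= b n + eps n.
  by rewrite addrC (le_trans (metric_triangle _ (T (s n) (x n)) _))// lerD2r.
have /cvg_ex[/= L aL] : cvgn a.
  apply: (cvgn_quasi_nonincreasing eps) => // n; first exact: mdist_ge0.
  by rewrite (le_trans (ab n))// lerD2r.
have eps0 : eps @ \oo --> 0 by exact: cvg_series_cvg_0.
have bL : b @ \oo --> L.
  apply: (@squeeze_cvgr _ _ _ _ (fun n => a n.+1 - eps n) a) => //.
    by apply: nearW => n; rewrite ba lerBlDr ab.
  by rewrite -[L]subr0; apply: cvgB => //; rewrite (cvg_shiftS a).
have Tx0 : mdist (T (s n) (x n)) (x n) @[n --> \oo] --> (0 : R).
  apply/cvgr0Pnorm_lt => e e0.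
  (* The exponent and the constant depend on [i], so each map gets its own threshold; finitely many
     indices allow a common one, and then [i] is taken to be [s n]. *)
  have : \forall n \near \oo, forall i, s n = i -> mdist (T i (x n)) (x n) < e.
    apply: filter_forall => i.
    apply: (propertyP1_displacement_cvg0 b [set n | s n = i]
      (T_P1 i) (pfix i I)) aL bL _ e0 => // n.
      exact: mdist_ge0.
    by move=> <-.
  by apply: filterS => n /(_ _ erefl); rewrite ger0_norm ?mdist_ge0.
rewrite /asymptotically_regular.
apply: (@squeeze_cvgr _ _ _ _ (fun=> 0)
  (fun n => mdist (T (s n) (x n)) (x n) + eps n)).
(* Triangle inequality through the exact image [T (s n) (x n)]. *)
- apply: nearW => n; rewrite mdist_ge0/=.
  rewrite (le_trans (metric_triangle _ (T (s n) (x n)) _))//.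
  by rewrite metric_sym lerD2l metric_sym.
- exact: cvg_cst.
- by rewrite -[0]addr0; apply: cvgD.
Qed.
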